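(* Let $(P,\le,{}',0,1)$ be an orthoposet satisfying the Ascending Chain Condition and the following two conditions: (1) $L\Big(U\big(L(x,y),y'\big),y\Big)\subseteq L(x)$ for all $x,y\in P$; (2) $U\Big(L\big(U(x,y),y'\big),y\Big)\subseteq U(x)$ for all $x,y\in P$. Let $a,b,c\in P$. Then \[a\odot b\le c\quad\text{if and only if}\quad a\le b\to c.\]
   Context: An orthoposet is a bounded poset $(P,\le,{}',0,1)$ with an antitone involution ${}'$ (i.e. $x\le y$ implies $y'\le x'$, and $x''=x$) that is a complementation (i.e. $x\vee x'=1$ and $x\wedge x'=0$ for all $x$). The Ascending Chain Condition (ACC) means that there is no infinite ascending chain (in orthoposets it is equivalent to the Descending Chain Condition). For $A\subseteq P$: $L(A):=\{x\in P\mid x\le y\text{ for all }y\in A\}$, $U(A):=\{x\in P\mid y\le x\text{ for all }y\in A\}$; $\operatorname{Max}A$ and $\operatorname{Min}A$ denote the sets of all maximal and all minimal elements of $A$. When several arguments (elements and/or subsets) are listed inside $L$ or $U$, the operator is applied to the union of these sets, elements being read as singletons. For $A,B\subseteq P$, $A\le B$ means $x\le y$ for all $x\in A$ and all $y\in B$, with elements identified with singletons. The binary operators $\odot$ and $\to$ (with values subsets of $P$) are defined, for $x,y\in P$, by $x\odot y:=\operatorname{Max}L\big(y,U(x,y')\big)$ and $x\to y:=\operatorname{Min}U\big(x',L(x,y)\big)$. *)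

(* Defs.v *)
From mathcomp Require Import all_boot all_order.
From mathcomp Require Import boolp classical_sets.

Set Implicit Arguments.
Unset Strict Implicit.
Unset Printing Implicit Defensive.

Local Open Scope classical_set_scope.
Local Open Scope order_scope.

(* The supremum and the infimum of x and x' are required to exist and to be
   the bounds; other pairs of elements need not have joins or meets. *)
Record orthocomplementation (d : Order.disp_t) (P : tbPOrderType d)
    (compl : P -> P) : Prop := Orthocomplementation {
  compl_antitone : forall x y : P, x <= y -> compl y <= compl x;
  compl_involutive : forall x : P, compl (compl x) = x;
  compl_join : forall x : P, supremums [set x; compl x] \top;
  compl_meet : forall x : P, infimums [set x; compl x] \bot
}.

Definition ascending_chain_condition (d : Order.disp_t) (P : porderType d) :
  Prop := ~ exists f : nat -> P, forall n : nat, f n < f n.+1.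

Definition Max_set (d : Order.disp_t) (P : porderType d) (A : set P) : set P :=
  [set x | A x /\ forall y : P, A y -> x <= y -> y = x].

Definition Min_set (d : Order.disp_t) (P : porderType d) (A : set P) : set P :=
  [set x | A x /\ forall y : P, A y -> y <= x -> y = x].

Definition set_le (d : Order.disp_t) (P : porderType d) (A B : set P) : Prop :=
  forall x y : P, A x -> B y -> x <= y.

(* L and U are lbound and ubound; a list of arguments inside L or U stands for
   their union, so that, e.g., L(y, U(x, y')) is
   lbound ([set y] `|` ubound [set x; compl y]). *)
Definition odot (d : Order.disp_t) (P : porderType d) (compl : P -> P)
    (x y : P) : set P :=
  Max_set (lbound ([set y] `|` ubound [set x; compl y])).

Definition oarrow (d : Order.disp_t) (P : porderType d) (compl : P -> P)
    (x y : P) : set P :=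
  Min_set (ubound ([set compl x] `|` lbound [set x; y])).

(* Main.v *)
Require Import Defs.
From mathcomp Require Import all_boot all_order.
From mathcomp Require Import boolp classical_sets.

(** Write [x'] for the complement, [L] for [lbound] and [U] for [ubound].
    The chain condition lets the operators [Max] and [Min] be erased from the
    two sides: every element of a set lies below a maximal one
    ([ACC_le_Max_set]), and dually, by applying the involution, above a minimal
    one ([ACC_Min_set_le]). So the theorem amounts to

      [L(b, U(a, b'))] lies below [c]  iff  [a] lies below [U(b', L(b, c))].

    Left to right, [L(b, U(a, b'))] consists of lower bounds of both [b] and
    [c], so every element of [U(b', L(b, c))] is in [U(L(U(a, b'), b), b')],
    which is contained in [U(a)] by the second condition at [(a, b')], since
    [b'' = b].  Right to left, [U(b', L(b, c))] is contained in [U(a, b')], so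
    every element of [L(b, U(a, b'))] is in [L(U(L(c, b), b'), b)], which is
    contained in [L(c)] by the first condition at [(c, b)]. *)

Import Order.TTheory.

Local Open Scope classical_set_scope.
Local Open Scope order_scope.

(** If no maximal element of [A] were above [x], every element of [A] above [x]
    would have a strictly larger one in [A], and iterating a choice of it from
    [x] would give an infinite ascending chain. *)
Lemma ACC_le_Max_set {d : Order.disp_t} {P : porderType d}
    (accP : ascending_chain_condition P) {A : set P} {x : P} :
  A x -> exists2 m, Max_set A m & x <= m.
Proof.
move=> Ax; apply: contrapT => noMax; apply: accP.
have next y : exists z, A y /\ x <= y -> A z /\ y < z.
  have [[Ay xy]|nAy] := pselect (A y /\ x <= y); last by exists y.
  apply: contrapT => noz; apply: noMax; exists y => //; split=> // z Az yz.
  apply: contrapT => /eqP zy; apply: noz; exists z => _; split=> //.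
  by rewrite lt_neqAle eq_sym zy.
have [f fP] := choice next.
have fA n : A (iter n f x) /\ x <= iter n f x.
  elim: n => [|n IHn] //=; have [Af ltf] := fP _ IHn.
  by split=> //; apply: le_trans IHn.2 (ltW ltf).
by exists (fun n => iter n f x) => n; apply: (fP _ (fA n)).2.
Qed.

(** The involution reverses the order, so the complement of a maximal element
    of the set of complements of [A] is minimal in [A]. *)
Lemma ACC_Min_set_le {d : Order.disp_t} {P : tbPOrderType d} {compl : P -> P}
    (orthoP : orthocomplementation compl)
    (accP : ascending_chain_condition P) {A : set P} {x : P} :
  A x -> exists2 m, Min_set A m & m <= x.
Proof.
case: orthoP => anti inv _ _ Ax.
have [|m [Am maxm] xm] :=
  @ACC_le_Max_set _ _ accP [set y | A (compl y)] (compl x).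
  by rewrite /= inv.
exists (compl m); last by rewrite -[x]inv; apply: anti.
split=> // y Ay ym; rewrite -[y]inv (maxm (compl y)) //= ?inv //.
by rewrite -[m]inv; apply: anti.
Qed.

Lemma set_le_Max_set {d : Order.disp_t} {P : porderType d}
    (accP : ascending_chain_condition P) (A B : set P) :
  set_le (Max_set A) B <-> set_le A B.
Proof.
split=> leAB x y Ax By; last exact: leAB Ax.1 By.
have [m Mm xm] := ACC_le_Max_set accP Ax.
exact: le_trans xm (leAB _ _ Mm By).
Qed.

Lemma set_le_Min_set {d : Order.disp_t} {P : tbPOrderType d} {compl : P -> P}
    (orthoP : orthocomplementation compl)
    (accP : ascending_chain_condition P) (A B : set P) :
  set_le A (Min_set B) <-> set_le A B.
Proof.
split=> leAB x y Ax By; last exact: leAB Ax By.1.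
have [m Mm my] := ACC_Min_set_le orthoP accP By.
exact: le_trans (leAB _ _ Ax Mm) my.
Qed.

Theorem theorem5p1 (d : Order.disp_t) (P : tbPOrderType d) (compl : P -> P)
  (orthoP : orthocomplementation compl)
  (accP : ascending_chain_condition P)
  (cond1 : forall x y : P,
     lbound (ubound (lbound [set x; y] `|` [set compl y]) `|` [set y])
       `<=` lbound [set x])
  (cond2 : forall x y : P,
     ubound (lbound (ubound [set x; y] `|` [set compl y]) `|` [set y])
       `<=` ubound [set x])
  (a b c : P) :
  set_le (odot compl a b) [set c] <-> set_le [set a] (oarrow compl b c).
Proof.
rewrite /odot /oarrow (set_le_Max_set accP) (set_le_Min_set orthoP accP).
split=> [Lc _ u -> Uu|aU l _ Ll ->].
- apply: (cond2 a (compl b) u) => // z [Lz|->]; last by apply: Uu; left.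
  rewrite (compl_involutive orthoP) setUC in Lz.
  apply: Uu; right=> _ [->|->]; first by apply: Lz; left.
  exact: Lc Lz erefl.
- apply: (cond1 c b l) => // z [Uz|->]; last by apply: Ll; left.
  apply: Ll; right=> _ [->|->]; last by apply: Uz; right.
  by apply: aU => //; rewrite setUC [X in lbound X]setUC.
Qed.
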